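(* Consider the adaptive shortest-path routing problem with light-tailed edge costs described in the context, with $m$ edges, path set $\mathcal{P}$, path-set dimension $d\le m$, barycentric spanner $B=\{\vec p_1,\dots,\vec p_d\}$, and constants $u_0>0$, $\zeta$, $a\in(0,1/(2\zeta)]$ valid for every edge cost as described in the context. Choose a constant $b>2m/a$, a constant $$c\in\Big(0,\ \min_{j:\ \mathbb{E}[C_t(\sigma(j))-C_t(\sigma(1))]>0}\mathbb{E}[C_t(\sigma(j))-C_t(\sigma(1))]\Big),$$ and a constant $w\ge\max\{b/(md\zeta u_0)^2,\ 4b/c^2\}$. Construct the exploration sequence by $\mathcal{A}(1)=\{1\}$ and, for each $t>1$: $\mathcal{A}(t)=\mathcal{A}(t-1)\cup\{t\}$ if $|\mathcal{A}(t-1)|<d\lceil d^2w\log t\rceil$, and $\mathcal{A}(t)=\mathcal{A}(t-1)$ otherwise. Let $\pi^*$ be the Adaptive Shortest-Path Routing Algorithm (defined in the context) run with this exploration sequence. Then there is a constant $A$, independent of $d$, $m$ and $T$ (it may depend on the other constants $a,\zeta,u_0,b,c,w$ and on the edge cost distributions), such that for all $T>1$ $$R^{\pi^*}(T)\le A\,m\,d^3\log T .$$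
   Context: Problem. $G=(V,E)$ is a finite directed graph consisting of all simple paths from a source $s$ to a destination $r$; $m=|E|$, and $\mathcal{P}$ is the (finite) set of all paths from $s$ to $r$ in $G$. At each time $t=1,2,\dots$ each edge $e\in E$ is assigned a random cost $W_e(t)$ with unknown distribution; the cost vectors $(W_e(t))_{e\in E}$ are i.i.d. over $t$. At each time $t$ a policy $\pi$ chooses, based on past observations, a path $p\in\mathcal{P}$, and then only the total cost $C_t(p)=\sum_{e\in p}W_e(t)$ is observed (individual edge costs are not). $C_t(\pi)$ denotes the total cost of the path chosen by $\pi$ at time $t$. Let $\sigma$ be an ordering of the paths with $\mathbb{E}[C_t(\sigma(1))]\le\mathbb{E}[C_t(\sigma(2))]\le\dots\le\mathbb{E}[C_t(\sigma(|\mathcal{P}|))]$. The regret is $R^{\pi}(T)=\mathbb{E}\big[\sum_{t=1}^T (C_t(\pi)-C_t(\sigma(1)))\big]$. Light-tailed costs. A random variable $X$ is light-tailed if there is $u_0>0$ with $\mathbb{E}[\exp(uX)]<\infty$ for all $|u|\le u_0$. All edge costs are light-tailed. The constants $u_0>0$ and $\zeta$ are such that, for every edge $e$, the moment-generating function $M_e$ of the centered cost $W_e(t)-\mathbb{E}[W_e(t)]$ is finite on $[-u_0,u_0]$ and $\zeta\ge\sup_{|u|\le u_0}M_e''(u)$; then $M_e(u)\le\exp(\zeta u^2/2)$ for $|u|\le u_0$, and for $a\in(0,1/(2\zeta)]$ and $\delta\in[0,\zeta u_0]$ the sample mean $\overline{X}_s$ of $s$ i.i.d. copies of the edge cost, with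 mean $\theta$, satisfies $\Pr(|\overline{X}_s-\theta|\ge\delta)\le 2\exp(-a\delta^2 s)$. Standing assumption on path costs: for each path $p\in\mathcal{P}$ the moment-generating function bound holds with $\zeta$ replaced by $m\zeta$, i.e. $\mathbb{E}[\exp(u(C_t(p)-\mathbb{E}[C_t(p)]))]\le\exp(m\zeta u^2/2)$ for $|u|\le u_0$ (and correspondingly the deviation bound holds for path costs with $\zeta$ replaced by $m\zeta$ and $a$ by $a/m$). Path vectors and barycentric spanner. Each path $p$ is identified with its $0/1$ incidence vector $\vec p\in\mathbb{R}^m$ (entry $1$ iff the edge is on the path); $d\le m$ is the dimension of the linear span of all path vectors. A barycentric spanner of the path set is a set $B=\{\vec p_1,\dots,\vec p_d\}$ of $d$ path vectors such that every path vector is a linear combination of elements of $B$ with coefficients in $[-1,1]$. Such a $B$ exists and is fixed; its paths are denoted $p_1,\dots,p_d$. Algorithm. $\mathcal{A}(t)\subseteq\{1,\dots,t\}$ is the set of exploration times up to and including $t$, with $|\mathcal{A}(t)|$ its cardinality. For positive integers $k,l$ let $k\oslash l=((k-1)\bmod l)+1$. Let $\overline\theta_{p_i}(t)$ ($i=1,\dots,d$) be the sample mean of the past cost observations on path $p_i$. At time $t$: if $t\in\mathcal{A}(t)$, choose path $p_n$ with $n=|\mathcal{A}(t)|\oslash d$. If $t\notin\mathcal{A}(t)$, then for every $p\in\mathcal{P}$ write $\vec p=\sum_{i=1}^d a_i\vec p_i$ with $|a_i|\le1$, set $\overline\theta_p(t)=\sum_{i=1}^d a_i\overline\theta_{p_i}(t)$,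 and choose a path minimizing $\overline\theta_p(t)$ over $p\in\mathcal{P}$. *)

(* Defs.v *)
From HB Require Import structures.
From mathcomp Require Import all_boot all_order all_algebra finmap.
From mathcomp Require Import all_classical all_reals all_analysis.

Set Implicit Arguments.
Unset Strict Implicit.
Unset Printing Implicit Defensive.

Import Order.TTheory GRing.Theory Num.Theory numFieldNormedType.Exports.
Local Open Scope ring_scope.

(* A finite directed graph is a relation [g] on a finite type of vertices;
   its edges are the pairs related by [g]. *)
Notation edge g := {e | g e.1 e.2}.

(* The set of simple paths from [s] to [r], a path being given by the set of
   its edges; a simple path is determined by this set. *)
Definition spaths (V : finType) (g : rel V) (s r : V) : {set {set edge g}} :=
  finset (fun p : {set edge g} => `[<exists q : seq V,
    [/\ path g s q, last s q = r, uniq (s :: q) &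
        forall e : edge g, (e \in p) = (val e \in zip (s :: q) q)]>]).

Definition union_of_spaths (V : finType) (g : rel V) (s r : V) : Prop :=
  [/\ s != r,
      forall e : edge g, exists2 p, p \in spaths g s r & e \in p &
      forall v : V, exists2 p, p \in spaths g s r &
        exists2 e, e \in p & (v == (val e).1) || (v == (val e).2)].

Section path_vectors.
Context (R : realType) (V : finType) (g : rel V).

Definition path_vec (p : {set edge g}) : 'rV[R]_#|{: edge g}| :=
  \row_i (enum_val i \in p)%:R.

Definition path_dim (s r : V) : nat :=
  \dim <<[seq path_vec p | p <- enum (spaths g s r)]>>%VS.

Definition spanner_coef (d : nat) (B : d.-tuple {set edge g})
    (p : {set edge g}) (al : 'I_d -> R) : Prop :=
  (forall i, `|al i| <= 1) /\
  path_vec p = \sum_(i < d) al i *: path_vec (tnth B i).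

Definition barycentric_spanner (s r : V) (d : nat)
    (B : d.-tuple {set edge g}) : Prop :=
  [/\ d = path_dim s r, uniq B, {subset B <= spaths g s r} &
      forall p, p \in spaths g s r -> exists al, spanner_coef B p al].

End path_vectors.

Fixpoint explore (R : realType) (w : R) (d t : nat) : {fset nat} :=
  if t is k.+1 then
    let A := explore w d k in
    if (k == 0%N) || (#|` A|%:R < d%:R *
         (Num.ceil (d%:R ^+ 2 * w * ln (t%:R : R)))%:~R :> R)
    then (t |` A)%fset else A
  else fset0.

Definition oslash (k l : nat) : nat := ((k - 1) %% l).+1.

Section random_variables.
Context (R : realType) (dO : measure_display) (Omega : measurableType dO)
  (P : probability Omega R).

Definition light_tailed (X : Omega -> R) : Prop :=
  exists2 u0 : R, 0 < u0 & forall u, `|u| <= u0 -> ('M_P X u < +oo)%E.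

Definition centered_mgf (X : Omega -> R) : R -> \bar R :=
  'M_P (fun x => X x - fine 'E_P[X]).

(* The second derivative is taken at interior points, where it is two-sided;
   its supremum there is also the supremum over the closed interval of
   E[(X - E X)^2 exp(u (X - E X))]. *)
Definition mgf_bounds (u0 zeta : R) (X : Omega -> R) : Prop :=
  (forall u, `|u| <= u0 -> (centered_mgf X u < +oo)%E) /\
  (forall u, `|u| < u0 ->
     derive1n 2 (fun v => fine (centered_mgf X v)) u <= zeta).

(* Times start at 1: the variable of index 0 plays no role. *)
Definition iid (dT : measure_display) (T : measurableType dT)
    (X : nat -> {RV P >-> T}) : Prop :=
  (forall t, (0 < t)%N ->
     forall B, measurable B -> distribution P (X t) B = distribution P (X 1%N) B)
  /\
  (forall (J : {fset nat}) (B : nat -> set T),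
     (forall t, t \in J -> (0 < t)%N) -> (forall t, measurable (B t)) ->
     (P (\bigcap_(t in [set t | t \in J]) (X t @^-1` B t))%classic =
      \prod_(t <- J) P (X t @^-1` B t)%classic)%E).

End random_variables.

Section routing.
Context (R : realType) (dO : measure_display) (Omega : measurableType dO)
  (P : probability Omega R) (V : finType) (g : rel V)
  (W : nat -> {RV P >-> #|{: edge g}|.-tuple R}).

Definition edge_cost (t : nat) (e : edge g) (x : Omega) : R :=
  tnth (W t x) (enum_rank e).

Definition path_cost (t : nat) (p : {set edge g}) (x : Omega) : R :=
  \sum_(e in p) edge_cost t e x.

(* [sigma] lists the paths by increasing mean cost, the best one first; the
   cost vectors being identically distributed, the means are those at time 1. *)
Definition path_ordering (s r : V) (sigma : seq {set edge g}) : Prop :=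
  perm_eq sigma (enum (spaths g s r)) /\
  sorted (fun p q => ('E_P[path_cost 1 p] <= 'E_P[path_cost 1 q])%E) sigma.

Definition gap (sigma : seq {set edge g}) (j : nat) : \bar R :=
  'E_P[fun x => (path_cost 1 (nth finset.set0 sigma j) x
                - path_cost 1 (nth finset.set0 sigma 0) x)%R]%E.

Variable pi : nat -> Omega -> {set edge g}.

Definition observed_cost (t : nat) (x : Omega) : R := path_cost t (pi t x) x.

(* The choice made at time [t] is measurable with respect to the sigma-algebra
   generated by the costs observed before [t]. *)
Definition nonanticipating : Prop :=
  forall (t : nat) (p : {set edge g}), (0 < t)%N ->
    (<<s \bigcup_(k in [set k : nat | (0 < k < t)%N])
           preimage_set_system setT (observed_cost k) measurable >>
       [set x | pi t x = p])%classic.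

(* Observations made outside the exploration times count as well. *)
Definition sample_mean (p : {set edge g}) (t : nat) (x : Omega) : R :=
  (\sum_(1 <= k < t | pi k x == p) observed_cost k x)
  / (\sum_(1 <= k < t | pi k x == p) 1)%N%:R.

Definition path_estimate (d : nat) (B : d.-tuple {set edge g})
    (al : 'I_d -> R) (t : nat) (x : Omega) : R :=
  \sum_(i < d) al i * sample_mean (tnth B i) t x.

(* [pi] is a run of the routing algorithm with exploration sequence [A]; ties
   between minimizers may be broken in any way that only uses past observations.
   The ordinal [i] stands for the [i.+1]-th path of [B]. *)
Definition adaptive_routing (s r : V) (d : nat) (B : d.-tuple {set edge g})
    (A : nat -> {fset nat}) : Prop :=
  nonanticipating /\
  exists2 al : {set edge g} -> 'I_d -> R,
    forall p, p \in spaths g s r -> spanner_coef B p (al p) &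
    forall t x, (0 < t)%N ->
      if t \in A t then
        forall i : 'I_d, i.+1 = oslash #|` A t| d -> pi t x = tnth B i
      else
        pi t x \in spaths g s r /\
        forall p, p \in spaths g s r ->
          path_estimate B (al (pi t x)) t x <= path_estimate B (al p) t x.

Definition regret (sigma : seq {set edge g}) (T : nat) : \bar R :=
  'E_P[fun x => (\sum_(1 <= t < T.+1)
         (observed_cost t x - path_cost t (nth finset.set0 sigma 0) x))%R]%E.

End routing.

(* Main.v *)
(* A choice made at time [t] depends on the costs before [t] only, hence is
   independent of the costs at time [t]; so the expected regret is the sum over
   [t] of the mean gaps weighted by the probabilities of the choices, and it
   suffices to bound the number of exploration times and the probability of a
   suboptimal choice at every other time.

   The number of samples of a path is random, as exploitation also produces
   samples. If [E (exp (h (W t))) <= 1] then the product of [exp (h (W k))] over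
   the past times [k] at which a given path was chosen has mean at most 1; with
   [h = +- u (C - theta) - v], Markov's inequality bounds the deviation of the
   sample mean uniformly over all sample sizes [N] that are at least the
   deterministic number [d^2 w ln t] guaranteed by exploration. Taking
   [delta = sqrt (b / w) / d], [u = delta / (m zeta)], [v = m zeta u^2 / 2], each
   of the [2 d] deviations has probability at most [t^-2], and outside of them
   all the path estimates are within [d delta <= c / 2] of the true means, so
   the chosen path is optimal. *)

Require Import Defs.
From HB Require Import structures.
From mathcomp Require Import all_boot all_order all_algebra finmap.
From mathcomp Require Import all_classical all_reals all_analysis.
From mathcomp Require Import measurable_realfun lra ring.

Set Implicit Arguments.
Unset Strict Implicit.
Unset Printing Implicit Defensive.

Import Order.TTheory GRing.Theory Num.Theory numFieldNormedType.Exports.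
Local Open Scope ring_scope.

(** * Independence of the present from the past *)

Section independence.
Context (R : realType) (dO : measure_display) (Omega : measurableType dO)
  (P : probability Omega R).

Local Open Scope ereal_scope.
Local Open Scope classical_set_scope.

(** Independence on rectangles identifies the joint law of [X] and [Y] with the product of their
    laws, and Tonelli's theorem factors the integral. Nonnegativity replaces any integrability
    assumption. *)
Lemma ge0_expectationM_indep (X Y : Omega -> R) :
  measurable_fun setT X -> measurable_fun setT Y ->
  (forall x, 0 <= X x)%R -> (forall x, 0 <= Y x)%R ->
  (forall A B, measurable A -> measurable B ->
    P (X @^-1` A `&` Y @^-1` B) = P (X @^-1` A) * P (Y @^-1` B)) ->
  \int[P]_x (X x * Y x)%:E = \int[P]_x (X x)%:E * \int[P]_x (Y x)%:E.
Proof.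
move=> mX mY X0 Y0 indXY.
pose RX := HB.pack X (isMeasurableFun.Build _ _ _ _ X mX) : {RV P >-> R}.
pose RY := HB.pack Y (isMeasurableFun.Build _ _ _ _ Y mY) : {RV P >-> R}.
have mXY : measurable_fun setT (fun x => (X x, Y x)).
  exact: measurable_fun_pair.
pose RXY := HB.pack (fun x => (X x, Y x))
  (isMeasurableFun.Build _ _ _ _ (fun x => (X x, Y x)) mXY) : {RV P >-> (R * R)%type}.
pose f : R * R -> \bar R := fun z => (`|z.1 * z.2|)%:E.
have mf : measurable_fun setT f.
  apply/measurable_EFinP; apply: measurableT_comp => //.
  exact: measurable_funM.
have -> : \int[P]_x (X x * Y x)%:E = \int[P]_x (f \o RXY) x.
  by apply: eq_integral => x _; rewrite /f/= ger0_norm ?mulr_ge0.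
rewrite -ge0_integral_distribution//; last by move=> z; rewrite lee_fin.
rewrite (eq_measure_integral (distribution P RX \x distribution P RY)); first last.
  move=> A mA _.
  by apply/esym/product_measure_unique => // A1 A2 mA1 mA2; exact: indXY.
rewrite fubini_tonelli1//; last by move=> z; rewrite lee_fin.
rewrite /fubini_F ge0_integral_distribution; last 2 first.
- by apply: (measurable_fun_fubini_tonelli_F f) => // z; rewrite lee_fin.
- by move=> x; apply: integral_ge0 => y _; rewrite lee_fin.
have -> : \int[P]_x ((fun x0 : R => \int[distribution P RY]_y f (x0, y)) \o RX) x
  = \int[P]_x ((X x)%:E * \int[P]_y (Y y)%:E).
  apply: eq_integral => x _ /=.
  rewrite ge0_integral_distribution; last 2 first.
  - by apply: measurableT_comp => //; exact: measurable_pair1.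
  - by move=> y; rewrite lee_fin.
  rewrite -ge0_integralZl ?lee_fin//; last 2 first.
  - exact: measurableT_comp.
  - by move=> y _; rewrite lee_fin.
  by apply: eq_integral => y _; rewrite /f/= ger0_norm ?mulr_ge0// EFinM.
rewrite ge0_integralZr//.
- exact: measurableT_comp.
- by move=> x _; rewrite lee_fin.
- by apply: integral_ge0 => y _; rewrite lee_fin.
Qed.

Context (dT : measure_display) (T : measurableType dT)
  (X : nat -> {RV P >-> T}).

(** Generated by the full variables and not only by what the policy observes: the larger
    sigma-algebra is still independent of [X t]. *)
Definition past (t : nat) : set (set Omega) :=
  \bigcup_(k in [set k : nat | (0 < k < t)%N])
    preimage_set_system setT (X k) measurable.

(** Unlike the generators in [past], these rectangles are closed under intersection, as uniqueness
    of measures requires. *)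
Let cylinder t : set (set Omega) :=
  [set E | exists2 B : nat -> set T, forall k, measurable (B k) &
    E = \bigcap_(k in [set k : nat | (0 < k < t)%N]) X k @^-1` B k].

Lemma past_measurable t : <<s past t >> `<=` measurable.
Proof.
apply: smallest_sub; first exact: sigma_algebra_measurable.
move=> E [k _ [B mB <-]].
exact: measurable_funPT.
Qed.

Lemma past_sub (k t : nat) : (k <= t)%N -> <<s past k >> `<=` <<s past t >>.
Proof.
move=> kt; apply: sub_sigma_algebra2 => E [j /= /andP[j0 jk] Ej].
by exists j => //=; rewrite j0 (leq_trans jk).
Qed.

Lemma cylinder_setI_closed t : setI_closed (cylinder t).
Proof.
move=> _ _ [B mB ->] [C mC ->]; exists (fun k => B k `&` C k).
  by move=> k; exact: measurableI.
by rewrite -bigcapI.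
Qed.

Lemma cylinder_measurable t : cylinder t `<=` measurable.
Proof.
move=> _ [B mB ->]; apply: bigcap_measurableType => // k _.
by rewrite -[X in measurable X]setTI; exact: measurable_funPT.
Qed.

Lemma past_sub_cylinder t : <<s past t >> `<=` <<s cylinder t >>.
Proof.
apply: sub_sigma_algebra2 => E [k /= kt [B mB <-]].
exists (fun j => if j == k then B else setT).
  by move=> j; case: ifP.
rewrite setTI; apply/seteqP; split => [x Bx j _|x /(_ k kt)] /=.
  by case: eqP => // ->.
by rewrite eqxx.
Qed.

Hypothesis iidX : iid X.

Lemma iid_prefix (n : nat) (B : nat -> set T) : (forall k, measurable (B k)) ->
  P (\bigcap_(k in [set k : nat | (0 < k < n.+1)%N]) X k @^-1` B k) =
  \prod_(1 <= k < n.+1) P (X k @^-1` B k).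
Proof.
move=> mB; have [_ indX] := iidX.
have -> : [set k : nat | (0 < k < n.+1)%N] = [set` seq_fset tt (iota 1 n)].
  by apply/seteqP; split => k; rewrite /mkset seq_fsetE mem_iota add1n.
rewrite indX//; last by move=> k; rewrite seq_fsetE mem_iota => /andP[].
rewrite (perm_big _ (seq_fset_perm _ _)) undup_id ?iota_uniq//=.
by rewrite /index_iota subSS subn0.
Qed.

(* Both sides are finite measures of [F] that agree on a pi-system generating
   the past. *)
Lemma past_indep (t : nat) (F : set Omega) (B : set T) : (0 < t)%N ->
  <<s past t >> F -> measurable B ->
  P (F `&` X t @^-1` B) = P F * P (X t @^-1` B).
Proof.
case: t => // t _ /past_sub_cylinder cF mB.
have mC : measurable (X t.+1 @^-1` B).
  by rewrite -[X in measurable X]setTI; exact: measurable_funPT.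
have C0 : (0 <= fine (P (X t.+1 @^-1` B)))%R by exact: fine_ge0.
pose m1 := mrestr P mC; pose m2 := mscale (NngNum C0) P.
suff : m1 F = m2 F.
  by rewrite /m1 /m2 /mrestr /mscale/= muleC fineK// fin_num_measure.
apply: (g_sigma_algebra_measure_unique (cylinder t.+1) _ (fun=> setT)) => //.
- exact: cylinder_measurable.
- by move=> _; exists (fun=> setT) => //; rewrite bigcapT.
- by rewrite bigcup_const.
- exact: cylinder_setI_closed.
- move=> _ [D mD ->]; rewrite -[LHS]/(m1 _) -[RHS]/(m2 _).
  rewrite /m1 /m2 /mrestr /mscale/= fineK ?fin_num_measure//.
  rewrite iid_prefix// muleC.
  (* The event on [X t.+1] becomes one more coordinate of the rectangle, so that the product formula
     applies to a prefix of length [t.+1]. *)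
  transitivity (P (\bigcap_(k in [set k | (0 < k < t.+2)%N])
    X k @^-1` (if k == t.+1 then B else D k))).
    congr (P _); apply/seteqP; split => [x [Dx Bx] k /= /andP[k0]|x BDx].
      rewrite ltnS leq_eqVlt; case: eqP => [->//|_ /= kt].
      by apply: Dx => /=; rewrite k0.
    split; last by have /= := BDx t.+1; rewrite eqxx; apply.
    move=> k /= /andP[k0 kt]; have := BDx k; rewrite /= k0 ltnS (ltnW kt).
    by rewrite ltn_eqF// => /(_ erefl).
  rewrite (@iid_prefix t.+1 (fun k => if k == t.+1 then B else D k)); last first.
    by move=> k; case: ifP.
  rewrite big_nat_recr//= eqxx; congr (_ * _).
  by apply: eq_big_nat => k /andP[_ kt]; rewrite ltn_eqF.
- move=> _; rewrite -[X in X < _]/(m1 _) /m1 /mrestr.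
  by rewrite setTI -ge0_fin_numE// fin_num_measure.
Qed.

End independence.

(** * Adapted functions and an exponential supermartingale *)

Section adapted.
Context (R : realType) (dO : measure_display) (Omega : measurableType dO)
  (P : probability Omega R) (dT : measure_display) (T : measurableType dT)
  (X : nat -> {RV P >-> T}).

Local Open Scope ereal_scope.
Local Open Scope classical_set_scope.

(** Retyping the domain with the past sigma-algebra lets the ordinary closure lemmas for measurable
    functions prove adaptedness. *)
Definition adapted (t : nat) d (U : measurableType d) (f : Omega -> U) : Prop :=
  measurable_fun setT (f : g_sigma_algebraType (past X t) -> U).

Lemma adapted_measurable_fun t d (U : measurableType d) (f : Omega -> U) :
  adapted t f -> measurable_fun setT f.
Proof. by move=> af _ B mB; apply: (@past_measurable _ _ _ _ _ _ X t); exact: af. Qed.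

Lemma adapted_le (s t : nat) d (U : measurableType d) (f : Omega -> U) :
  (s <= t)%N -> adapted s f -> adapted t f.
Proof. by move=> st af _ B mB; apply: (past_sub st); exact: af. Qed.

Lemma adapted_last (t : nat) : (0 < t)%N -> adapted t.+1 (X t).
Proof.
move=> t0 _ B mB; apply: sub_sigma_algebra; exists t; last by exists B.
by rewrite /= t0 ltnSn.
Qed.

Lemma adapted_bool (t : nat) (b : Omega -> bool) :
  <<s past X t >> [set x | b x] -> adapted t b.
Proof.
by move=> mb; apply: (@measurable_fun_bool _ (g_sigma_algebraType (past X t)) _ _ true);
  rewrite setTI.
Qed.

Hypothesis iidX : iid X.

Lemma ge0_expectationM_adapted (t : nat) (L : Omega -> R) (f : T -> R) :
  (0 < t)%N -> adapted t L -> measurable_fun setT f ->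
  (forall x, 0 <= L x)%R -> (forall y, 0 <= f y)%R ->
  \int[P]_x (L x * f (X t x))%:E =
  \int[P]_x (L x)%:E * \int[P]_x (f (X t x))%:E.
Proof.
move=> t0 aL mf L0 f0; apply: ge0_expectationM_indep => //.
- exact: adapted_measurable_fun aL.
- exact: measurableT_comp.
move=> A B mA mB.
rewrite -[(fun x => f (X t x)) @^-1` B]/(X t @^-1` (f @^-1` B)).
apply: past_indep => //.
- by rewrite -[X in smallest _ _ X]setTI; exact: aL.
- by rewrite -[X in measurable X]setTI; exact: mf.
Qed.

Lemma natr_bool_measurable : measurable_fun setT (fun c : bool => c%:R : R).
Proof. by []. Qed.

Section selected.
Variables (b : nat -> Omega -> bool) (Y : T -> R).
Hypothesis ab : forall k, (0 < k)%N -> adapted k (b k).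
Hypothesis mY : measurable_fun setT Y.
Hypothesis Y0 : forall y, (0 <= Y y)%R.

Let L n x := (\prod_(1 <= k < n | b k x) Y (X k x))%R.

Let LS n x : (0 < n)%N -> L n.+1 x = (L n x * (if b n x then Y (X n x) else 1))%R.
Proof. by move=> n0; rewrite /L big_mkcond/= big_nat_recr//= -big_mkcond. Qed.

Let L_ge0 n x : (0 <= L n x)%R. Proof. by apply: prodr_ge0. Qed.

Lemma adapted_selected_prod n : adapted n (L n).
Proof.
have L1 m : (m <= 1)%N -> adapted m (L m).
  move=> m1; rewrite (_ : L m = cst 1%R); first exact: measurable_cst.
  by apply/funext => x; rewrite /L big_geq.
elim: n => [|[|n] IH]; [exact: L1|exact: L1|].
rewrite (_ : L n.+2 = fun x => L n.+1 x * (if b n.+1 x then Y (X n.+1 x) else 1))%R;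
  last by apply/funext => x; exact: LS.
apply: measurable_funM; first exact: adapted_le IH.
apply: measurable_fun_ifT => //.
- by apply: adapted_le (ab _).
- by apply: measurableT_comp => //; exact: adapted_last.
Qed.

Hypothesis EY1 : forall k, (0 < k)%N -> \int[P]_x (Y (X k x))%:E <= 1.

(** Whether time [n] is selected is decided by the past, so a selected factor is independent of the
    product before it and has mean at most 1; an unselected time leaves the product unchanged. *)
Lemma selected_prod_supermartingale n : \int[P]_x (L n x)%:E <= 1.
Proof.
have L1 m : (m <= 1)%N -> \int[P]_x (L m x)%:E <= 1.
  move=> m1; rewrite (_ : (fun x => (L m x)%:E) = cst 1).
    by rewrite integral_cst// mul1e probability_le1.
  by apply/funext => x; rewrite /L big_geq.
elim: n => [|[|n] IH]; [exact: L1|exact: L1|].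
have aL (c : Omega -> bool) : adapted n.+1 c ->
    adapted n.+1 (fun x => L n.+1 x * (c x)%:R)%R.
  move=> ac; apply: measurable_funM; first exact: adapted_selected_prod.
  by apply: measurableT_comp; [exact: natr_bool_measurable|exact: ac].
have aLb := aL _ (ab (ltn0Sn n)).
have mLb := adapted_measurable_fun aLb.
have mLN : measurable_fun setT (fun x => (L n.+1 x * (~~ b n.+1 x)%:R)%R).
  by apply: adapted_measurable_fun; apply: aL; apply: measurable_neg; exact: ab.
(* This splitting is used twice: with [g] the new factor, then backwards with [g = 1] to recover the
   integral of the previous product. *)
have split_sum (g : Omega -> R) : (forall x, 0 <= g x)%R -> measurable_fun setT g ->
  \int[P]_x (L n.+1 x * (~~ b n.+1 x)%:R)%:E
  + \int[P]_x (L n.+1 x * (b n.+1 x)%:R * g x)%:E =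
  \int[P]_x (L n.+1 x * (if b n.+1 x then g x else 1))%:E.
  move=> g0 mg; rewrite -ge0_integralD//.
  - apply: eq_integral => x _; rewrite -EFinD; congr (_%:E).
    by case: (b n.+1 x) => /=; rewrite ?mulr0 ?add0r ?addr0 ?mulr1 ?mul0r ?addr0.
  - by move=> x _; rewrite lee_fin mulr_ge0.
  - exact/measurable_EFinP.
  - by move=> x _; rewrite lee_fin !mulr_ge0.
  - by apply/measurable_EFinP; exact: measurable_funM.
apply: (@le_trans _ _ (\int[P]_x (L n.+1 x)%:E)); last exact: IH.
under eq_integral do rewrite LS//.
rewrite -split_sum//; last exact: measurableT_comp.
rewrite (ge0_expectationM_adapted _ aLb)//; last first.
  by move=> x; rewrite mulr_ge0.
rewrite [leRHS](_ : _ =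
    \int[P]_x (L n.+1 x * (if b n.+1 x then 1 else 1))%:E); last first.
  by apply: eq_integral => x _; rewrite if_same mulr1.
rewrite -(split_sum (cst 1%R))//.
apply: leeD2l.
under [leRHS]eq_integral do rewrite mulr1.
rewrite -[leRHS]mule1; apply: lee_wpmul2l; last exact: EY1.
by apply: integral_ge0 => x _; rewrite lee_fin mulr_ge0.
Qed.

End selected.

(** Markov's inequality for the product of the selected [expR (h (X k))], a supermartingale started
    at 1. The bound does not depend on how many times are selected, which is random. *)
Lemma selected_sum_deviation (b : nat -> Omega -> bool) (h : T -> R) (r : R) n :
  (forall k, (0 < k)%N -> adapted k (b k)) ->
  measurable_fun setT h ->
  (forall k, (0 < k)%N -> \int[P]_x (expR (h (X k x)))%:E <= 1) ->
  P [set x | r <= \sum_(1 <= k < n | b k x) h (X k x)]%R <= (expR (- r))%:E.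
Proof.
move=> ab mh Eh.
have mexp : measurable_fun setT (expR \o h) by exact: measurableT_comp.
pose L x := (\prod_(1 <= k < n | b k x) expR (h (X k x)))%R.
have mL : measurable_fun setT L.
  exact: adapted_measurable_fun (@adapted_selected_prod b (expR \o h) ab mexp n).
have L0 x : (0 <= L x)%R by apply: prodr_ge0 => k _; exact: expR_ge0.
have EL : \int[P]_x (L x)%:E <= 1.
  by apply: (@selected_prod_supermartingale b (expR \o h)) => // y; exact: expR_ge0.
have -> : [set x | r <= \sum_(1 <= k < n | b k x) h (X k x)]%R =
    setT `&` [set x | (expR r)%:E <= `|(L x)%:E|].
  rewrite setTI; apply/seteqP; split => x /=;
    by rewrite lee_fin ger0_norm// /L -expR_sum ler_expR.
rewrite expRN -[leRHS]mul1e lee_pdivlMr ?expR_gt0// muleC.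
apply: le_trans EL.
have -> : \int[P]_x (L x)%:E = \int[P]_x (id `|(EFin \o L) x|).
  by apply: eq_integral => x _; rewrite gee0_abs ?lee_fin.
apply: (@le_integral_comp_abse _ _ _ P _ measurableT (EFin \o L) _ id) => //.
- exact: measurableT_comp.
- exact: expR_gt0.
Qed.

End adapted.

(** * Counting exploration times and samples *)

Section exploration.
Context (R : realType) (w : R) (d : nat).
Local Notation A := (explore w d).

Lemma exploreE t : A t.+1 =
  if (t == 0%N) || (#|` A t|%:R < d%:R *
       (Num.ceil (d%:R ^+ 2 * w * ln (t.+1%:R : R)))%:~R :> R)
  then (t.+1 |` A t)%fset else A t.
Proof. by []. Qed.

Arguments explore : simpl never.

Lemma explore_le t k : k \in A t -> (k <= t)%N.
Proof.
elim: t => [|t IH]; first by rewrite in_fset0.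
rewrite exploreE; case: ifP => _; last by move/IH => /leqW.
by rewrite in_fset1U => /predU1P[->//|/IH /leqW].
Qed.

(** The threshold test is replaced by membership of the new time, which is unambiguous since [A t]
    only contains times up to [t]. *)
Lemma exploreS t : A t.+1 = if t.+1 \in A t.+1 then (t.+1 |` A t)%fset else A t.
Proof.
have /orP[] : (A t.+1 == (t.+1 |` A t)%fset) || (A t.+1 == A t).
- by rewrite exploreE; case: ifP; rewrite eqxx ?orbT.
- by move/eqP => ->; rewrite fset1U1.
- by move/eqP => ->; case: ifP => // /explore_le; rewrite ltnn.
Qed.

Lemma card_exploreS t : #|` A t.+1| = ((t.+1 \in A t.+1) + #|` A t|)%N.
Proof.
rewrite {1}exploreS; case: ifP => // _; rewrite cardfsU1.
by case: (boolP (t.+1 \in A t)) => // /explore_le; rewrite ltnn.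
Qed.

Lemma card_explore t : #|` A t| = (\sum_(1 <= k < t.+1) (k \in A k))%N.
Proof.
elim: t => [|t IH]; first by rewrite big_geq// cardfs0.
by rewrite card_exploreS big_nat_recr//= IH addnC.
Qed.

Lemma explore1 : 1%N \in A 1.
Proof. by rewrite exploreE fset1U1. Qed.

Lemma notin_explore t : (0 < t)%N -> t \notin A t ->
  (1 < t)%N /\
  d%:R * (Num.ceil (d%:R ^+ 2 * w * ln (t%:R : R)))%:~R <= #|` A t.-1|%:R :> R.
Proof.
case: t => [//|[|t]] _; first by rewrite explore1.
by rewrite exploreE; case: ifP => [|/negbT]; [rewrite fset1U1|rewrite -leNgt].
Qed.

(** When a time is added, the cardinality was still below the threshold, so it exceeds it by at most
    1 afterwards; the threshold grows with [t], and the ceiling costs less than 1. *)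
Lemma explore_card_le t : 0 <= w -> (0 < t)%N ->
  #|` A t|%:R <= 1 + d%:R * (d%:R ^+ 2 * w * ln t%:R + 1) :> R.
Proof.
move=> w0; elim: t => [//|[|t] IH] _.
  rewrite card_exploreS explore1/= addn0 ln1 mulr0 add0r mulr1.
  by rewrite lerDl.
have {}IH := IH isT; rewrite card_exploreS; case: (boolP (_ \in _)) => /= [tA|_].
  rewrite add1n -natr1 addrC lerD2l.
  have {}tA : #|` A t.+1|%:R <
      d%:R * (Num.ceil (d%:R ^+ 2 * w * ln (t.+2%:R : R)))%:~R :> R.
    move: tA; rewrite exploreE; case: ifP => // _ /explore_le.
    by rewrite ltnn.
  rewrite (le_trans (ltW tA))// ler_wpM2l// -lerBlDr.
  by have /ltW := ceilB1_lt (d%:R ^+ 2 * w * ln t.+2%:R); rewrite intrB.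
rewrite add0n (le_trans IH)// lerD2l ler_wpM2l// lerD2r ler_wpM2l//.
  by rewrite mulr_ge0// exprn_ge0.
by rewrite ler_ln ?posrE ?ltr0n// ler_nat.
Qed.

(** Along the exploration times, the cardinality takes each value from 1 to its final one exactly
    once. *)
Lemma explore_count (i t : nat) :
  (\sum_(1 <= k < t.+1 | k \in A k) (oslash #|` A k| d == i.+1) =
   \sum_(1 <= j < #|` A t|.+1) (oslash j d == i.+1))%N.
Proof.
elim: t => [|t IH]; first by rewrite !big_geq.
rewrite big_mkcond big_nat_recr//= -big_mkcond IH card_exploreS.
case: (t.+1 \in _); last by rewrite addn0 add0n.
by rewrite add1n [RHS]big_nat_recr.
Qed.

(** Each of the [K] consecutive blocks of length [d] meets the residue [i] once. *)
Lemma oslash_count (i K n : nat) : (i < d)%N -> (d * K <= n)%N ->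
  (K <= \sum_(1 <= j < n.+1) (oslash j d == i.+1))%N.
Proof.
move=> id dKn.
under eq_bigr do rewrite /oslash eqSS subn1.
rewrite big_add1/= (big_cat_nat (n := d * K))//=.
apply: leq_trans (leq_addr _ _).
elim: K {dKn} => // K IH; rewrite mulnS addnC.
rewrite (big_cat_nat (n := d * K)) ?leq_addr//= -addn1 leq_add//.
rewrite -{1}[(d * K)%N]add0n big_addn addKn.
under eq_bigr do rewrite addnC mulnC modnMDl.
by rewrite big_mkord (bigD1 (Ordinal id))//= modn_small// eqxx.
Qed.

(** Skipping exploration at [t] means that at least [d] times the ceiling explorations are done, and
    the round robin gives every spanner path its share. Choices outside exploration can only add
    samples. *)
Lemma explore_samples (U : eqType) (B : d.-tuple U) (q : nat -> U) (t : nat) :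
  (0 < t)%N -> t \notin A t ->
  (forall k, (0 < k < t)%N -> k \in A k ->
     forall i : 'I_d, i.+1 = oslash #|` A k| d -> q k = tnth B i) ->
  forall i : 'I_d, d%:R ^+ 2 * w * ln t%:R <=
    (\sum_(1 <= k < t | q k == tnth B i) 1)%N%:R :> R.
Proof.
move=> t0 tA qB i; have [t1 Ale] := notin_explore t0 tA.
apply: (le_trans (ceil_ge _)).
(* A negative ceiling makes the bound trivial. *)
case: (Num.ceil _) Ale => [K|K _]; last first.
  by rewrite (le_trans _ (ler0n _ _))// lerz0.
rewrite -natrM ler_nat => dKA; rewrite ler_nat.
rewrite (leq_trans (oslash_count (ltn_ord i) dKA))// -explore_count prednK//.
rewrite big_mkcond [leqRHS]big_mkcond/=.
rewrite big_nat [leqRHS]big_nat leq_sum// => k kt.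
case: ifP => // kA; case: (eqVneq (oslash _ _)) => //= oi.
by rewrite (qB k kt kA i)// eqxx.
Qed.

End exploration.

(** * Expectations of light-tailed and of i.i.d. variables *)

Section expectation.
Context (R : realType) (dO : measure_display) (Omega : measurableType dO)
  (P : probability Omega R).

Local Open Scope ereal_scope.
Local Open Scope classical_set_scope.

(** Domination: [u |X|] is at most [expR (u X) + expR (- u X)], because [1 + y <= expR y]. *)
Lemma light_tailed_integrable (X : Omega -> R) : measurable_fun setT X ->
  light_tailed P X -> P.-integrable setT (EFin \o X).
Proof.
move=> mX [u u0 MX].
have mexp v : measurable_fun setT (fun x => expR (v * X x)).
  by apply: measurableT_comp => //; exact: measurable_funM.
have iexp v : (`|v| <= u)%R -> P.-integrable setT (fun x => (expR (v * X x))%:E).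
  move=> /MX; rewrite /mmt_gen_fun unlock => Moo; apply/integrableP; split.
    exact: measurableT_comp.
  rewrite (le_lt_trans _ Moo)// le_eqVlt; apply/predU1l/eq_integral => x _ /=.
  by rewrite ger0_norm ?expR_ge0// mulrC.
have iS : P.-integrable setT
    (fun x => (u^-1)%:E * ((expR (u * X x))%:E + (expR (- u * X x))%:E)).
  apply: integrableZl => //; apply: integrableD => //; apply: iexp.
    by rewrite gtr0_norm.
  by rewrite normrN gtr0_norm.
apply: le_integrable iS => //; first exact: measurableT_comp.
move=> x _; rewrite /= lee_fin -[X in (_ <= `|X|)%R]/(u^-1 * _)%R.
rewrite [leRHS]ger0_norm; last first.
  by rewrite mulr_ge0 ?invr_ge0 ?(ltW u0)// addr_ge0// expR_ge0.
rewrite ler_pdivlMl// -[in leLHS](gtr0_norm u0) -normrM mulNr.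
have e1 := expR_ge1Dx (u * X x); have e2 := expR_ge1Dx (- (u * X x)).
have p1 := expR_ge0 (u * X x); have p2 := expR_ge0 (- (u * X x)).
by rewrite ler_norml; apply/andP; split; lra.
Qed.

Lemma expectation_natr_bool (b : Omega -> bool) : measurable [set x | b x] ->
  \int[P]_x ((b x)%:R : R)%:E = P [set x | b x].
Proof.
move=> mb; rewrite -[in RHS](setIT [set x | b x]) -integral_indic//.
apply: eq_integral => x _; rewrite indicE; congr (_%:R%:E).
by apply/esym; case: (boolP (b x)) => bx; [rewrite mem_set|rewrite memNset//; apply/negP].
Qed.

Context (dT : measure_display) (T : measurableType dT)
  (X : nat -> {RV P >-> T}).
Hypothesis iidX : iid X.

Lemma ge0_iid_expectation (t : nat) (f : T -> \bar R) : (0 < t)%N ->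
  measurable_fun setT f -> (forall y, 0 <= f y) ->
  \int[P]_x f (X t x) = \int[P]_x f (X 1%N x).
Proof.
move=> t0 mf f0.
rewrite -[LHS]/(\int[P]_x (f \o X t) x) -[RHS]/(\int[P]_x (f \o X 1%N) x).
rewrite -!ge0_integral_distribution//; apply: eq_measure_integral => A mA _.
by have [+ _] := iidX; apply.
Qed.

Lemma iid_expectation (t : nat) (f : T -> R) : (0 < t)%N ->
  measurable_fun setT f ->
  \int[P]_x (f (X t x))%:E = \int[P]_x (f (X 1%N x))%:E.
Proof.
move=> t0 mf; have mEf : measurable_fun setT (EFin \o f) by exact: measurableT_comp.
rewrite integralE [RHS]integralE; congr (_ - _).
- rewrite (eq_integral (fun x => (EFin \o f)^\+ (X t x))); last first.
    by move=> x _; rewrite !funeposE.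
  rewrite (ge0_iid_expectation t0 (measurable_funepos mEf) (funepos_ge0 _)).
  by apply: eq_integral => x _; rewrite !funeposE.
- rewrite (eq_integral (fun x => (EFin \o f)^\- (X t x))); last first.
    by move=> x _; rewrite !funenegE.
  rewrite (ge0_iid_expectation t0 (measurable_funeneg mEf) (funeneg_ge0 _)).
  by apply: eq_integral => x _; rewrite !funenegE.
Qed.

(** The event [b] belongs to the past and is thus independent of [X t]. The nonnegative case is
    applied to the positive and negative parts, with which the factor [b] commutes. *)
Lemma expectation_adapted_if (t : nat) (b : Omega -> bool) (f : T -> R) :
  (0 < t)%N -> adapted X t b -> measurable_fun setT f ->
  P.-integrable setT (fun x => (f (X t x))%:E) ->
  \int[P]_x ((b x)%:R * f (X t x))%:E =
  P [set x | b x] * \int[P]_x (f (X t x))%:E.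
Proof.
move=> t0 ab mf intf.
have mb : measurable [set x | b x].
  have /(_ measurableT [set true] _) := adapted_measurable_fun ab.
  by rewrite setTI; apply.
have Eg (g : T -> R) : measurable_fun setT g -> (forall y, 0 <= g y)%R ->
    \int[P]_x ((b x)%:R * g (X t x))%:E = P [set x | b x] * \int[P]_x (g (X t x))%:E.
  move=> mg g0; rewrite -expectation_natr_bool//.
  rewrite (ge0_expectationM_adapted iidX (L := fun x => (b x)%:R))//.
  by apply: measurableT_comp; [exact: natr_bool_measurable|exact: ab].
rewrite integralE [in RHS]integralE muleBr ?fin_num_measure//; last first.
  exact: integrable_add_def intf.
congr (_ - _).
- rewrite (eq_integral (fun x => ((b x)%:R * Num.max (f (X t x)) 0)%:E)).
    rewrite (Eg (fun y => Num.max (f y) 0)%R).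
    + by congr (_ * _); apply: eq_integral => x _; rewrite funeposE EFin_max.
    + exact: measurable_maxr.
    + by move=> y; rewrite le_max lexx orbT.
  move=> x _; rewrite funeposE -EFin_max; congr (_%:E).
  by case: (b x); rewrite ?mul1r// !mul0r maxxx.
- rewrite (eq_integral (fun x => ((b x)%:R * Num.max (- f (X t x)) 0)%:E)).
    rewrite (Eg (fun y => Num.max (- f y) 0)%R).
    + by congr (_ * _); apply: eq_integral => x _; rewrite funenegE EFin_max.
    + by apply: measurable_maxr => //; exact: measurableT_comp.
    + by move=> y; rewrite le_max lexx orbT.
  move=> x _; rewrite funenegE -EFinN -EFin_max; congr (_%:E).
  by case: (b x); rewrite ?mul1r// !mul0r oppr0 maxxx.
Qed.

End expectation.

(** * Path costs and their means *)

Section routing.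
Context (R : realType) (dO : measure_display) (Omega : measurableType dO)
  (P : probability Omega R) (V : finType) (g : rel V)
  (W : nat -> {RV P >-> #|{: edge g}|.-tuple R}).

Local Open Scope classical_set_scope.

(** The path cost as a deterministic function of the cost vector, the form in which the i.i.d.
    lemmas apply. *)
Definition total_cost (p : {set edge g}) (y : #|{: edge g}|.-tuple R) : R :=
  \sum_(e in p) tnth y (enum_rank e).

Lemma measurable_total_cost p : measurable_fun setT (total_cost p).
Proof.
rewrite (_ : total_cost p = fun y =>
    \sum_(e : edge g) (if e \in p then tnth y (enum_rank e) else 0)); last first.
  by apply/funext => y; rewrite -big_mkcond.
by apply: measurable_sum => e; case: (e \in p) => //; exact: measurable_tnth.
Qed.

Lemma measurable_path_cost t p : measurable_fun setT (path_cost W t p).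
Proof. exact: (measurableT_comp (measurable_total_cost p)). Qed.

Section choice.
Variable pi : nat -> Omega -> {set edge g}.
Hypothesis nonanticip : nonanticipating W pi.

(** Strong induction on time: the choice at [t] is a function of earlier observed costs, and each of
    these is determined by an earlier choice, adapted by induction, and by the cost vector of that
    time. *)
Lemma adapted_choice t (p : {set edge g}) : (0 < t)%N ->
  adapted W t (fun x => pi t x == p).
Proof.
elim/ltn_ind: t p => t IH p t0; apply: adapted_bool.
rewrite (_ : [set x | pi t x == p] = [set x | pi t x = p]); last first.
  by apply/seteqP; split => x /=; [move/eqP|move=> ->].
apply: smallest_sub (nonanticip p t0); first exact: smallest_sigma_algebra.
move=> _ [k /= /andP[k0 kt]] [C mC <-].
suff : adapted W t (observed_cost W pi k) by apply.
rewrite (_ : observed_cost W pi k =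
    fun x => \sum_(q : {set edge g}) (pi k x == q)%:R * total_cost q (W k x)); last first.
  apply/funext => x; rewrite (bigD1 (pi k x))//= eqxx mul1r big1 ?addr0//.
  by move=> q /negPf; rewrite eq_sym => ->; rewrite mul0r.
apply: measurable_sum => q; apply: measurable_funM.
  apply: measurableT_comp; first exact: natr_bool_measurable.
  by apply: (adapted_le (ltnW kt)); exact: IH.
apply: measurableT_comp; first exact: measurable_total_cost.
by apply: (adapted_le kt); exact: adapted_last.
Qed.

End choice.

Hypothesis iidW : iid W.

Definition mean_cost (p : {set edge g}) : R := fine ('E_P[path_cost W 1 p])%E.

Hypothesis intW : forall t e, (0 < t)%N ->
  P.-integrable setT (EFin \o edge_cost W t e).

Lemma integrable_path_cost t p : (0 < t)%N ->
  P.-integrable setT (EFin \o path_cost W t p).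
Proof.
move=> t0; rewrite (_ : _ \o _ = fun x => (\sum_(e in p) (edge_cost W t e x)%:E)%E).
  by apply: integrable_sum => // e _; exact: intW.
by apply/funext => x; rewrite sumEFin.
Qed.

Lemma expectation_path_cost t p : (0 < t)%N ->
  ('E_P[path_cost W t p] = (mean_cost p)%:E)%E.
Proof.
move=> t0; rewrite /mean_cost unlock fineK; last first.
  by apply: integrable_fin_num => //; exact: integrable_path_cost.
exact: (iid_expectation iidW t0 (measurable_total_cost p)).
Qed.

Definition mean_edge (e : edge g) : R := fine (\int[P]_x (edge_cost W 1 e x)%:E)%E.

Lemma mean_costE p : mean_cost p = \sum_(e in p) mean_edge e.
Proof.
rewrite /mean_cost unlock /path_cost.
under eq_integral do rewrite -sumEFin.
rewrite integral_sum//=; last by move=> e; exact: intW.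
rewrite sum_fine// => e _; apply: integrable_fin_num => //; exact: intW.
Qed.

(** The mean cost is a linear function of the incidence vector, so it inherits the spanner
    decomposition. *)
Lemma mean_cost_spanner (d : nat) (B : d.-tuple {set edge g}) p al :
  spanner_coef B p al -> mean_cost p = \sum_(i < d) al i * mean_cost (tnth B i).
Proof.
move=> [_ pB].
have mE q : mean_cost q = \sum_e (e \in q)%:R * mean_edge e.
  rewrite mean_costE big_mkcond; apply: eq_bigr => e _.
  by case: (e \in q); rewrite ?mul1r ?mul0r.
rewrite mE; under [RHS]eq_bigr do rewrite mE mulr_sumr.
rewrite exchange_big/=; apply: eq_bigr => e _.
have := congr1 (fun v : 'rV[R]_#|{: edge g}| => v 0 (enum_rank e)) pB.
rewrite summxE mxE enum_rankK => ->; rewrite mulr_suml.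
by apply: eq_bigr => i _; rewrite !mxE enum_rankK mulrA.
Qed.

Lemma mean_cost_le (M : R) p : (forall e, `|mean_edge e| <= M) ->
  `|mean_cost p| <= #|{: edge g}|%:R * M.
Proof.
move=> eM; rewrite mean_costE (le_trans (ler_norm_sum _ _ _))//.
rewrite big_mkcond mulr_natl -sumr_const; apply: ler_sum => e _.
by case: ifP => // _; rewrite (le_trans _ (eM e)).
Qed.

End routing.

(** * Regret at one time, and deviations along chosen times *)

Section regret_bound.
Context (R : realType) (dO : measure_display) (Omega : measurableType dO)
  (P : probability Omega R) (V : finType) (g : rel V)
  (W : nat -> {RV P >-> #|{: edge g}|.-tuple R})
  (pi : nat -> Omega -> {set edge g}).
Hypothesis nonanticip : nonanticipating W pi.
Hypothesis iidW : iid W.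
Hypothesis intW : forall t e, (0 < t)%N ->
  P.-integrable setT (EFin \o edge_cost W t e).

Local Open Scope classical_set_scope.

Lemma choice_measurable t p : (0 < t)%N -> measurable [set x | pi t x == p].
Proof.
move=> t0; have /(_ measurableT [set true] _) :=
  adapted_measurable_fun (adapted_choice nonanticip p t0).
by rewrite setTI; apply.
Qed.

Definition instant_regret q t x : R := observed_cost W pi t x - path_cost W t q x.

Definition choice_prob t p : R := fine (P [set x | pi t x == p]).

Lemma instant_regretE q t : instant_regret q t = fun x =>
  \sum_p (pi t x == p)%:R * (total_cost p (W t x) - total_cost q (W t x)).
Proof.
apply/funext => x; rewrite (bigD1 (pi t x))//= eqxx mul1r big1 ?addr0//.
by move=> p /negPf; rewrite eq_sym => ->; rewrite mul0r.
Qed.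

Let integrable_diff t p q : (0 < t)%N ->
  P.-integrable setT (fun x => (total_cost p (W t x) - total_cost q (W t x))%:E).
Proof.
move=> t0; have := integrableB measurableT (integrable_path_cost intW p t0)
  (integrable_path_cost intW q t0).
by apply: eq_integrable => // x _; rewrite /= EFinB.
Qed.

Let integrable_choice_diff t p q : (0 < t)%N -> P.-integrable setT
  (fun x => ((pi t x == p)%:R * (total_cost p (W t x) - total_cost q (W t x)))%:E).
Proof.
move=> t0; apply: le_integrable (integrable_diff p q t0) => //.
  apply/measurable_EFinP; apply: measurable_funM.
    apply: measurableT_comp; first exact: natr_bool_measurable.
    exact: adapted_measurable_fun (adapted_choice nonanticip p t0).
  by apply: measurable_funB; apply: measurableT_comp => //; exact: measurable_total_cost.
move=> x _; rewrite lee_fin normrM ler_piMl//.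
by case: eqP; rewrite ?normr1// normr0.
Qed.

Lemma integrable_instant_regret q t : (0 < t)%N ->
  P.-integrable setT (EFin \o instant_regret q t).
Proof.
move=> t0; rewrite instant_regretE.
rewrite (_ : _ \o _ = fun x => (\sum_p
    ((pi t x == p)%:R * (total_cost p (W t x) - total_cost q (W t x)))%:E)%E).
  by apply: integrable_sum => // p _; exact: integrable_choice_diff.
by apply/funext => x; rewrite sumEFin.
Qed.

(** Decomposing over the chosen path, each choice indicator is independent of the costs at [t], so
    only the mean gap remains beside its probability. *)
Lemma expectation_instant_regret q t : (0 < t)%N ->
  (\int[P]_x (instant_regret q t x)%:E =
   (\sum_p choice_prob t p * (mean_cost W p - mean_cost W q))%:E)%E.
Proof.
move=> t0; rewrite instant_regretE.
under eq_integral do rewrite -sumEFin.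
rewrite integral_sum//=; last by move=> p; exact: integrable_choice_diff.
rewrite -sumEFin; apply: eq_bigr => p _.
have mB : measurable_fun setT (fun y => total_cost p y - total_cost q y : R).
  by apply: measurable_funB; exact: measurable_total_cost.
have -> := expectation_adapted_if iidW t0 (adapted_choice nonanticip p t0) mB
  (integrable_diff p q t0).
rewrite EFinM fineK ?fin_num_measure//; last exact: choice_measurable.
congr (_ * _)%E; rewrite EFinB -!(expectation_path_cost iidW intW _ t0).
rewrite !expectation.unlock.
under eq_integral do rewrite EFinB.
by rewrite integralB//; exact: integrable_path_cost.
Qed.

(** The bound on the moment-generating function says that [expR (u (C - theta) - v)] has mean at
    most 1, which is the hypothesis of [selected_sum_deviation] for the times at which [p] is
    chosen. *)
Lemma choice_deviation (p : {set edge g}) (u v r : R) t :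
  (forall k, (0 < k)%N -> (centered_mgf P (path_cost W k p) u <= (expR v)%:E)%E) ->
  (P [set x | (r <= \sum_(1 <= k < t | pi k x == p)
      (u * (path_cost W k p x - mean_cost W p) - v))%R] <= (expR (- r))%:E)%E.
Proof.
move=> mgf.
apply: (@selected_sum_deviation _ _ _ _ _ _ W iidW (fun k x => pi k x == p)
  (fun y => u * (total_cost p y - mean_cost W p) - v)).
- by move=> k k0; exact: adapted_choice.
- apply: measurable_funB => //; apply: measurable_funM => //.
  by apply: measurable_funB => //; exact: measurable_total_cost.
move=> k k0; have := mgf k k0.
rewrite /centered_mgf /mmt_gen_fun (expectation_path_cost iidW intW _ k0)/=.
rewrite expectation.unlock => Ek.
rewrite (eq_integral (fun x => (expR (- v))%:E *
  ((expR \o u \o* (fun z => path_cost W k p z - mean_cost W p)) x)%:E)%E);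
  last first.
  by move=> x _; rewrite /= -EFinM -expRD; congr (expR _)%:E; rewrite [RHS]addrC mulrC.
rewrite ge0_integralZl//.
- rewrite expRN muleC; apply: (le_trans (lee_wpmul2r _ Ek)).
    by rewrite lee_fin invr_ge0 expR_ge0.
  by rewrite -EFinM divff// gt_eqF// expR_gt0.
- have mp : measurable_fun setT (fun x => total_cost p (W k x)).
    by apply: measurableT_comp => //; exact: measurable_total_cost.
  have mup : measurable_fun setT (fun x => (total_cost p (W k x) - mean_cost W p) * u).
    by apply: measurable_funM => //; exact: measurable_funB.
  by apply/measurable_EFinP; exact: (measurableT_comp (@measurable_expR R) mup).
- by move=> x _; rewrite lee_fin expR_ge0.
Qed.

End regret_bound.

(** * Probability of a suboptimal choice *)

Section suboptimal_choice.
Context (R : realType) (dO : measure_display) (Omega : measurableType dO)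
  (P : probability Omega R) (V : finType) (g : rel V)
  (W : nat -> {RV P >-> #|{: edge g}|.-tuple R})
  (pi : nat -> Omega -> {set edge g}).

Local Notation samples p t x := (\sum_(1 <= k < t | pi k x == p) 1)%N.

(** With [N] samples, the two sums are [N] times [+- u (mean - theta) - v]. Since [r] is at most
    [N (u delta - v)], a sum below [r] keeps the signed error below [delta]. *)
Lemma sample_mean_deviation p t x (u v delta r : R) :
  0 < u -> (0 < samples p t x)%N -> r <= (samples p t x)%:R * (u * delta - v) ->
  \sum_(1 <= k < t | pi k x == p) (u * (path_cost W k p x - mean_cost W p) - v) < r ->
  \sum_(1 <= k < t | pi k x == p)
    (- u * (path_cost W k p x - mean_cost W p) - v) < r ->
  `|sample_mean W pi p t x - mean_cost W p| < delta.
Proof.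
move=> u0 N0 rN; set N := samples p t x in N0 rN *.
have NR0 : 0 < N%:R :> R by rewrite ltr0n.
have sumE z : \sum_(1 <= k < t | pi k x == p)
    (z * (path_cost W k p x - mean_cost W p) - v) =
    N%:R * (z * (sample_mean W pi p t x - mean_cost W p) - v).
  have -> : N%:R * (z * (sample_mean W pi p t x - mean_cost W p) - v) =
      z * (N%:R * sample_mean W pi p t x) - N%:R * (z * mean_cost W p + v) by ring.
  have -> : N%:R * sample_mean W pi p t x =
      \sum_(1 <= k < t | pi k x == p) observed_cost W pi k x.
    by rewrite /sample_mean mulrC divfK// gt_eqF.
  rewrite /N natr_sum mulr_suml mulr_sumr -sumrB.
  by apply: eq_bigr => k /eqP <-; rewrite /observed_cost; ring.
rewrite !sumE => up lo.
have := lt_le_trans up rN; rewrite ltr_pM2l// ltrD2r ltr_pM2l// => {}up.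
have := lt_le_trans lo rN.
rewrite ltr_pM2l// ltrD2r mulNr -mulrN ltr_pM2l// => {}lo.
by rewrite ltr_norml; apply/andP; split; lra.
Qed.

Hypothesis iidW : iid W.
Hypothesis intW : forall t e, (0 < t)%N ->
  P.-integrable setT (EFin \o edge_cost W t e).

(** Coefficients of absolute value at most 1 turn [d] errors below [delta] into an estimation error
    below [d delta] for every path. The gap of the minimizer is then at most its own error plus that
    of [q]. *)
Lemma estimated_choice_close (s r : V) (d : nat) (B : d.-tuple {set edge g})
    (al : {set edge g} -> 'I_d -> R) (delta : R) t x q : (0 < d)%N ->
  (forall p, p \in spaths g s r -> spanner_coef B p (al p)) ->
  (forall i, `|sample_mean W pi (tnth B i) t x - mean_cost W (tnth B i)| < delta) ->
  pi t x \in spaths g s r -> q \in spaths g s r ->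
  path_estimate W pi B (al (pi t x)) t x <= path_estimate W pi B (al q) t x ->
  mean_cost W (pi t x) - mean_cost W q < 2 * (d%:R * delta).
Proof.
move=> d0 alB close piS qS est.
have err p : p \in spaths g s r ->
    `|path_estimate W pi B (al p) t x - mean_cost W p| < d%:R * delta.
  move=> pS; rewrite (mean_cost_spanner intW (alB p pS)) /path_estimate -sumrB.
  rewrite (le_lt_trans (ler_norm_sum _ _ _))//.
  rewrite mulr_natl -[d in ltRHS]card_ord -sumr_const.
  apply: ltr_sum; first by apply/hasP; exists (Ordinal d0); rewrite ?mem_index_enum.
  move=> i _; rewrite -mulrBr normrM (le_lt_trans _ (close i))//.
  by rewrite ler_piMl//; have [+ _] := alB p pS; apply.
have := err _ piS; have := err _ qS.
by rewrite !ltr_norml => /andP[q1 q2] /andP[p1 p2]; lra.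
Qed.

Hypothesis nonanticip : nonanticipating W pi.

Lemma choice_predE (bad : pred {set edge g}) t x :
  (bad (pi t x))%:R = \sum_p (bad p)%:R * (pi t x == p)%:R :> R.
Proof.
rewrite (bigD1 (pi t x))//= eqxx mulr1 big1 ?addr0//.
by move=> p /negPf; rewrite eq_sym => ->; rewrite mulr0.
Qed.

Lemma measurable_choice p t : (0 < t)%N ->
  measurable_fun setT (fun x => (pi t x == p)%:R : R).
Proof.
move=> t0; apply: measurableT_comp; first exact: natr_bool_measurable.
exact: adapted_measurable_fun (adapted_choice nonanticip p t0).
Qed.

Lemma measurable_choice_pred (bad : pred {set edge g}) t : (0 < t)%N ->
  measurable_fun setT (fun x => (bad (pi t x))%:R : R).
Proof.
move=> t0; under eq_fun do rewrite choice_predE.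
apply: measurable_sum => p; apply: measurable_funM => //.
exact: measurable_choice.
Qed.

Lemma expectation_instant_regret_le (bad : pred {set edge g}) q (D : R) t :
  (0 < t)%N ->
  (forall x, mean_cost W (pi t x) - mean_cost W q <= D * (bad (pi t x))%:R) ->
  (\int[P]_x (instant_regret W pi q t x)%:E <=
   D%:E * \int[P]_x ((bad (pi t x))%:R : R)%:E)%E.
Proof.
move=> t0 leD; rewrite expectation_instant_regret//.
under [in leRHS]eq_integral do rewrite choice_predE -sumEFin.
rewrite ge0_integral_sum//; last first.
  move=> p; apply/measurable_EFinP; apply: measurable_funM => //.
  exact: measurable_choice.
rewrite (eq_bigr (fun p => ((bad p)%:R * choice_prob P pi t p)%:E)); last first.
  move=> p _; under eq_integral do rewrite EFinM.
  rewrite ge0_integralZl//; last first.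
    by apply/measurable_EFinP; exact: measurable_choice.
  rewrite expectation_natr_bool; last exact: (choice_measurable nonanticip).
  by rewrite EFinM fineK// fin_num_measure//; exact: (choice_measurable nonanticip).
rewrite sumEFin -EFinM lee_fin mulr_sumr; apply: ler_sum => p _.
(* The bound [leD] only concerns paths chosen at some outcome; any other path has choice probability
   0. *)
have [[x /eqP <-]|nop] := pselect (exists x, pi t x == p).
  by rewrite mulrA mulrC ler_wpM2r// fine_ge0.
rewrite /choice_prob (_ : [set x | _] = set0)%classic ?measure0 ?mul0r ?mulr0//.
by apply/seteqP; split => // x xp; apply: nop; exists x.
Qed.

(** Union bound over the upper and lower deviations of the [d] spanner paths: if none occurs, all
    sample means are [delta]-close and [estimated_choice_close] excludes a gap of [2 d delta]. *)
Lemma expectation_bad_choice (s r : V) (d : nat) (B : d.-tuple {set edge g})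
    (al : {set edge g} -> 'I_d -> R) (u v delta rho : R) t q :
  (0 < d)%N -> (0 < t)%N -> 0 < u ->
  (forall p, p \in spaths g s r -> spanner_coef B p (al p)) ->
  (forall x i, (0 < samples (tnth B i) t x)%N) ->
  (forall x i, rho <= (samples (tnth B i) t x)%:R * (u * delta - v)) ->
  (forall k i, (0 < k)%N ->
    (centered_mgf P (path_cost W k (tnth B i)) u <= (expR v)%:E)%E) ->
  (forall k i, (0 < k)%N ->
    (centered_mgf P (path_cost W k (tnth B i)) (- u) <= (expR v)%:E)%E) ->
  (forall x, pi t x \in spaths g s r) -> q \in spaths g s r ->
  (forall x, path_estimate W pi B (al (pi t x)) t x <= path_estimate W pi B (al q) t x) ->
  (\int[P]_x ((2 * (d%:R * delta) <= mean_cost W (pi t x) - mean_cost W q)%R%:R : R)%:E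
    <= (2 * d%:R * expR (- rho))%:E)%E.
Proof.
move=> d0 t0 u0 alB N0 rhoN mgf mgfN piS qS est.
pose E (z : R) i x := rho <= \sum_(1 <= k < t | pi k x == tnth B i)
  (z * (path_cost W k (tnth B i) x - mean_cost W (tnth B i)) - v).
have mE z i : measurable_fun setT (E z i).
  apply: measurable_fun_ler => //.
  under eq_fun do rewrite big_mkcond/= big_add1/=.
  apply: measurable_sum => k; apply: measurable_fun_ifT => //.
    exact: adapted_measurable_fun (adapted_choice nonanticip _ _).
  apply: measurable_funB => //; apply: measurable_funM => //.
  by apply: measurable_funB => //; exact: measurable_path_cost.
have mER z i : measurable_fun setT (fun x => ((E z i x)%:R : R)%:E).
  apply/measurable_EFinP.
  exact: (measurableT_comp (@natr_bool_measurable R) (mE z i)).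
have PE z i : (forall k, (0 < k)%N ->
    (centered_mgf P (path_cost W k (tnth B i)) z <= (expR v)%:E)%E) ->
    (\int[P]_x ((E z i x)%:R : R)%:E <= (expR (- rho))%:E)%E.
  move=> mgfz; rewrite expectation_natr_bool; last first.
    have /(_ measurableT [set true] _)%classic := mE z i.
    by rewrite setTI; apply.
  exact: choice_deviation.
apply: (@le_trans _ _
  (\int[P]_x (\sum_(i < d) ((E u i x)%:R%:E + (E (- u) i x)%:R%:E)))%E).
  apply: ge0_le_integral => //.
  - apply/measurable_EFinP.
    exact: (@measurable_choice_pred
      (fun p => 2 * (d%:R * delta) <= mean_cost W p - mean_cost W q)).
  - by apply: emeasurable_sum => i; exact: emeasurable_funD.
  move=> x _; under eq_bigr do rewrite -EFinD.
  rewrite sumEFin lee_fin.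
  have [[i Ei]|noE] := pselect (exists i, E u i x || E (- u) i x).
    rewrite (bigD1 i)//=; apply: ler_wpDr.
      by apply: sumr_ge0 => k _; rewrite addr_ge0.
    rewrite -natrD ler_nat (leq_trans (leq_b1 _))//.
    by move: Ei; case: (E u i x); case: (E (- u) i x).
  case: (boolP (2 * _ <= _)) => [|_]; last by apply: sumr_ge0 => k _; rewrite addr_ge0.
  rewrite leNgt (estimated_choice_close d0 alB _ (piS x) qS (est x))// => i.
  have /negP/norP[] : ~ (E u i x || E (- u) i x) by move=> Ei; apply: noE; exists i.
  by rewrite /E -!ltNge; exact: (sample_mean_deviation u0 (N0 x i) (rhoN x i)).
rewrite ge0_integral_sum//; last 2 first.
- by move=> i; exact: emeasurable_funD.
- by move=> i x _; rewrite adde_ge0.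
rewrite mulrAC mulr_natr -[d in leRHS]card_ord -sumr_const -sumEFin.
apply: lee_sum => i _; rewrite ge0_integralD// mulr_natl mulr2n EFinD.
by apply: leeD; apply: PE => k k0; [exact: mgf|exact: mgfN].
Qed.

End suboptimal_choice.

(** * The numerical constants *)

Section constants.
Context (R : realType).

(** Telescoping, as [t^-2] is at most [1 / (t - 1) - 1 / t]. *)
Lemma sum_inv_sqr_le (T : nat) : (0 < T)%N ->
  \sum_(1 <= t < T.+1) (if (1 < t)%N then t%:R ^- 2 else 0) <= 1 - T%:R^-1 :> R.
Proof.
case: T => // T _; elim: T => [|T IH]; first by rewrite big_nat1/= invr1 subrr.
rewrite big_nat_recr//=; apply: (le_trans (lerD IH (lexx _))).
have T0 : 0 < T.+1%:R :> R by rewrite ltr0n.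
rewrite -[T.+2%:R]natr1; set z := T.+1%:R in T0 *.
have -> : 1 - (z + 1)^-1 = 1 - z^-1 + (z * (z + 1))^-1.
  by field; rewrite !gt_eqF// ltr_wpDr.
rewrite lerD2l lef_pV2 ?posrE; nra.
Qed.

Lemma confidence_constants (u0 zeta a b c w m d : R) :
  0 < u0 -> 0 < a <= 1 / (2 * zeta) -> 0 < c -> 0 < m -> 0 < d ->
  2 * m / a < b ->
  Num.max (b / (m * d * zeta * u0) ^+ 2) (4 * b / c ^+ 2) <= w ->
  0 < w /\ exists u delta, [/\ 0 < u, u <= u0, 2 * (d * delta) <= c &
    2 <= d ^+ 2 * w * (u * delta - m * zeta * u ^+ 2 / 2)].
Proof.
move=> u00 /andP[a0 az] c0 m0 d0 mab; rewrite ge_max => /andP[w1 w2].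
have z0 : 0 < zeta.
  by have := lt_le_trans a0 az; rewrite div1r invr_gt0 pmulr_rgt0.
have b0 : 0 < b by apply: le_lt_trans mab; rewrite divr_ge0 ?mulr_ge0 ?ltW.
have w0 : 0 < w by apply: lt_le_trans w2; rewrite divr_gt0 ?mulr_gt0 ?exprn_gt0.
have mz0 : 0 < m * zeta by exact: mulr_gt0.
pose beta := Num.sqrt (b / w).
have beta0 : 0 < beta by rewrite sqrtr_gt0 divr_gt0.
have beta2 : beta ^+ 2 = b / w by rewrite sqr_sqrtr// ltW// divr_gt0.
have beta_le x : 0 < x -> b / x ^+ 2 <= w -> beta <= x.
  move=> x0; rewrite ler_pdivrMr ?exprn_gt0// mulrC -ler_pdivrMr// -beta2.
  by rewrite ler_sqr// nnegrE ltW.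
have beta_c : beta <= c / 2.
  apply: beta_le; first by rewrite divr_gt0.
  by rewrite expr_div_n invf_div mulrA [b * _]mulrC -natrX.
have beta_u : beta <= m * d * zeta * u0 by apply: beta_le; rewrite ?mulr_gt0.
(* With [delta = beta / d], the value [u = delta / (m zeta)] maximizes [u delta - m zeta u^2 / 2].
   The two lower bounds on [w] give [u <= u0] and [2 d delta <= c]. *)
split=> //; exists (beta / d / (m * zeta)), (beta / d); split.
- by rewrite !divr_gt0.
- rewrite !ler_pdivrMr//; apply: (le_trans beta_u).
  by rewrite le_eqVlt; apply/predU1l; ring.
- by rewrite [d * _]mulrC divfK ?gt_eqF//; lra.
- have -> : d ^+ 2 * w * (beta / d / (m * zeta) * (beta / d)
      - m * zeta * (beta / d / (m * zeta)) ^+ 2 / 2) = w * beta ^+ 2 / (2 * (m * zeta)).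
    by field; rewrite !gt_eqF.
  rewrite beta2 [w * _]mulrC divfK ?gt_eqF// ler_pdivlMr ?mulr_gt0//.
  (* The exponent equals [b / (2 m zeta)], and it is at least 2 because
     [4 m zeta < 2 a b zeta <= b]. *)
  have {}az : a * (2 * zeta) <= 1 by rewrite -ler_pdivlMr ?mulr_gt0.
  have {}mab : 2 * m < b * a by rewrite -ltr_pdivrMr.
  have z1 := ler_wpM2l (ltW b0) az.
  have := ltr_pM2r z0 (2 * m) (b * a); rewrite mab => z2.
  by lra.
Qed.

End constants.

(** * Nontriviality of the graph and of the spanner *)

Section graph.
Context (R : realType) (V : finType) (g : rel V).

Lemma union_of_spaths_edge (s r : V) : union_of_spaths g s r ->
  exists2 p, p \in spaths g s r & exists e, e \in p.
Proof. by move=> [_ _ /(_ s)[p pS [e ep _]]]; exists p => //; exists e. Qed.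

(** For [d = 0] the vector of [p] would be an empty sum, whereas its entry at [e] is 1. *)
Lemma spanner_size_gt0 (d : nat) (B : d.-tuple {set edge g}) p e (al : 'I_d -> R) :
  spanner_coef B p al -> e \in p -> (0 < d)%N.
Proof.
case: d B al => // B al [_ pB] ep.
have := congr1 (fun v : 'rV[R]_#|{: edge g}| => v 0 (enum_rank e)) pB.
by rewrite big_ord0 !mxE enum_rankK ep => /eqP; rewrite oner_eq0.
Qed.

End graph.

(** * A bound on edge means uniform over the allowed laws *)

Section laws.
Context (R : realType).
Local Open Scope classical_set_scope.

(** The sum of the absolute means over the finite family serves as bound; it is fixed before the
    graph is. *)
Lemma finite_laws_mean_bound (L : set (set R -> \bar R)) : finite_set L ->
  exists2 M : R, 0 <= M &
    forall mu, L mu -> `|fine (\int[mu]_y y%:E)%E| <= M.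
Proof.
pose f (mu : set R -> \bar R) : R := fine (\int[mu]_y y%:E)%E.
move=> /(finite_image f)/finite_seqP[s Ls].
exists (\sum_(x <- s) `|x|); first exact: sumr_ge0.
move=> mu Lmu; have : (f @` L) (f mu) by exists mu.
rewrite Ls /= => sx; rewrite (big_rem _ sx)/= lerDl.
exact: sumr_ge0.
Qed.

Lemma mean_pushforward (dO : measure_display) (Omega : measurableType dO)
    (P : probability Omega R) (X : Omega -> R) :
  P.-integrable setT (EFin \o X) ->
  (\int[P]_x (X x)%:E = \int[pushforward P X]_y y%:E)%E.
Proof.
move=> iX; have mX : measurable_fun setT X.
  by apply/measurable_EFinP; exact: measurable_int iX.
by rewrite (integral_pushforward mX (f := EFin)).
Qed.

End laws.

(* A depends on the constants and on the finite collection L of edge cost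
   distributions; the graph (hence m and d), the joint law of the costs, the
   spanner, the run of the algorithm and T are quantified after A. *)
Theorem theorem1 (R : realType) (u0 zeta a b c w : R)
    (L : set (set R -> \bar R)) (finL : finite_set L)
    (hu0 : 0 < u0) (ha : 0 < a <= 1 / (2 * zeta)) (hc : 0 < c) :
  exists A : R,
  forall (V : finType) (g : rel V) (s r : V)
    (dO : measure_display) (Omega : measurableType dO)
    (P : probability Omega R) (W : nat -> {RV P >-> #|{: edge g}|.-tuple R})
    (d : nat) (B : d.-tuple {set edge g}) (sigma : seq {set edge g})
    (pi : nat -> Omega -> {set edge g}),
  let m := #|{: edge g}| in
  union_of_spaths g s r ->
  iid W ->
  (forall e : edge g, L (pushforward P (edge_cost W 1 e))) ->
  (forall t (e : edge g), (0 < t)%N ->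
     light_tailed P (edge_cost W t e) /\
     mgf_bounds P u0 zeta (edge_cost W t e)) ->
  (forall t p (u : R), (0 < t)%N -> p \in spaths g s r -> `|u| <= u0 ->
     (centered_mgf P (path_cost W t p) u
        <= (expR (m%:R * zeta * u ^+ 2 / 2))%:E)%E) ->
  barycentric_spanner R s r B ->
  path_ordering W s r sigma ->
  2 * m%:R / a < b ->
  (forall j, (j < size sigma)%N ->
     (0 < gap W sigma j)%E -> (c%:E < gap W sigma j)%E) ->
  Num.max (b / (m%:R * d%:R * zeta * u0) ^+ 2) (4 * b / c ^+ 2) <= w ->
  adaptive_routing W pi s r B (explore w d) ->
  forall T : nat, (1 < T)%N ->
    (regret W pi sigma T <= (A * m%:R * d%:R ^+ 3 * ln T%:R)%:E)%E.
Proof.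
have [M M0 LM] := finite_laws_mean_bound finL.
(* Any gap of mean costs is at most [2 m M], and the summed probabilities of bad choices are at most
   [d^3 (w + 4 / ln 2) ln T]. *)
exists (2 * M * (w + 4 / ln 2)).
move=> V g s r dO Omega P W d B sigma pi m HG iidW LW Hedge Hmgf.
move=> [_ _ BS _] [permS _] mab Hgap hw [nonant [al alB run]] T T1.
have [p0 p0S [e0 ep0]] := union_of_spaths_edge HG.
have d0 : (0 < d)%N := spanner_size_gt0 (alB _ p0S) ep0.
have m0 : (0 < m)%N by apply/card_gt0P; exists e0.
have intW t e : (0 < t)%N -> P.-integrable setT (EFin \o edge_cost W t e).
  move=> t0; apply: light_tailed_integrable; last by have [] := Hedge t e t0.
  exact: (measurableT_comp (measurable_tnth _)).
have edgeM e : `|mean_edge W e| <= M.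
  by rewrite /mean_edge mean_pushforward; [exact: LM|exact: intW].
set q := nth finset.set0 sigma 0.
have memS p : (p \in sigma) = (p \in spaths g s r).
  by rewrite (perm_mem permS) mem_enum.
have qS : q \in spaths g s r.
  by rewrite -memS mem_nth// -has_predT; apply/hasP; exists p0; rewrite ?memS.
have gap_ge p : p \in spaths g s r -> 0 < mean_cost W p - mean_cost W q ->
    c < mean_cost W p - mean_cost W q.
  rewrite -memS => pS; have := Hgap (index p sigma); rewrite index_mem => /(_ pS).
  rewrite /gap nth_index// -[nth _ _ 0]/q.
  suff -> : ('E_P[fun x => (path_cost W 1 p x - path_cost W 1 q x)%R] =
      (mean_cost W p - mean_cost W q)%:E)%E by rewrite !lte_fin.
  rewrite EFinB -!(expectation_path_cost iidW intW (t := 1))// !expectation.unlock.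
  under eq_integral do rewrite EFinB.
  by rewrite integralB//; exact: integrable_path_cost.
have mR0 : 0 < m%:R :> R by rewrite ltr0n.
have dR0 : 0 < d%:R :> R by rewrite ltr0n.
have [w0 [u [delta [u_gt0 u_le delta_c kappa]]]] :=
  confidence_constants hu0 ha hc mR0 dR0 mab hw.
pose v := m%:R * zeta * u ^+ 2 / 2; rewrite -/v in kappa.
pose bad p := 2 * (d%:R * delta) <= mean_cost W p - mean_cost W q.
pose D := 2 * (m%:R * M).
have piS t x : (0 < t)%N -> pi t x \in spaths g s r.
  move=> t0; have := run t x t0; case: ifP => [_|_ [//]].
  have od : ((#|` explore w d t| - 1) %% d < d)%N by rewrite ltn_mod.
  by move=> /(_ (Ordinal od) erefl) ->; apply/BS/mem_tnth.
have diff_le t x : (0 < t)%N ->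
    mean_cost W (pi t x) - mean_cost W q <= D * (bad (pi t x))%:R.
  move=> t0; case: (boolP (bad (pi t x))) => [_|]; last first.
    (* A choice that is not bad has gap below [2 d delta <= c], whereas positive gaps exceed [c]; so
       its gap is not positive. *)
    rewrite /bad -ltNge => lt; rewrite mulr0 leNgt; apply/negP => /(gap_ge _ (piS t x t0)).
    by rewrite ltNge ltW// (lt_le_trans lt).
  have := mean_cost_le intW (pi t x) edgeM; have := mean_cost_le intW q edgeM.
  rewrite -/m !ler_norml /D mulr1 => /andP[? ?] /andP[? ?]; lra.
(* Bound on the probability of a bad choice: 1 at exploration times, [2 d t^-2] at the others, which
   all satisfy [1 < t]. *)
pose h t : R := (t \in explore w d t)%:R +
  2 * d%:R * (if (1 < t)%N then t%:R ^- 2 else 0).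
have bad_le t : (0 < t)%N -> (\int[P]_x ((bad (pi t x))%:R : R)%:E <= (h t)%:E)%E.
  move=> t0; have mbad := measurable_choice_pred nonant bad t0.
  have [tA|tA] := boolP (t \in explore w d t).
    apply: (@le_trans _ _ (\int[P]_x (cst 1 x))%E).
      apply: ge0_le_integral => //; first exact/measurable_EFinP.
      by move=> x _; rewrite lee_fin lern1 leq_b1.
    rewrite integral_cst// mul1e (le_trans (probability_le1 _ _))// lee_fin.
    rewrite /h tA lerDl mulr_ge0//; case: ifP => // _.
  have [t1 _] := notin_explore t0 tA.
  have lnt0 : 0 < ln t%:R :> R by rewrite ln_gt0// ltr1n.
  have samples_ge x (i : 'I_d) : d%:R ^+ 2 * w * ln t%:R <=
      (\sum_(1 <= k < t | pi k x == tnth B i) 1)%N%:R :> R.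
    apply: (explore_samples (q := fun k => pi k x) t0 tA) => k /andP[k0 _] kA j.
    by have := run k x k0; rewrite kA; apply.
  have dw0 : 0 < d%:R ^+ 2 * w by rewrite mulr_gt0 ?exprn_gt0.
  have kappa0 : 0 < u * delta - v.
    by rewrite -(pmulr_rgt0 _ dw0); apply: lt_le_trans kappa.
  have expln : expR (- (2 * ln t%:R)) = t%:R ^- 2 :> R.
    by rewrite expRN expRM_natl lnK// posrE ltr0n.
  rewrite /h (negbTE tA) add0r t1 -expln.
  apply: (expectation_bad_choice iidW intW nonant d0 t0 u_gt0 alB _ _ _ _ _ qS) => //.
  - move=> x i; rewrite -(ltr0n R); apply: lt_le_trans (samples_ge x i).
    exact: mulr_gt0.
  (* Here [rho = 2 ln t]: the sample bound [d^2 w ln t] times [u delta - v] is at least this by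
     [kappa]. *)
  - move=> x i; apply: le_trans (ler_wpM2r (ltW kappa0) (samples_ge x i)).
    by rewrite mulrAC ler_wpM2r// ltW.
  - by move=> k i k0; apply: Hmgf => //; [exact/BS/mem_tnth|rewrite gtr0_norm].
  - move=> k i k0; have -> : v = m%:R * zeta * (- u) ^+ 2 / 2 by rewrite sqrrN.
    by apply: Hmgf => //; [exact/BS/mem_tnth|rewrite normrN gtr0_norm].
  - by move=> x; exact: piS.
  - by move=> x; have := run t x t0; rewrite (negbTE tA) => -[_]; apply.
have hsum : \sum_(1 <= t < T.+1) h t <= d%:R ^+ 3 * (w + 4 / ln 2) * ln T%:R.
  rewrite big_split/= -mulr_sumr -natr_sum -card_explore.
  have T0 : (0 < T)%N by exact: ltnW.
  have cA := explore_card_le d (ltW w0) T0.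
  have S1 : \sum_(1 <= t < T.+1) (if (1 < t)%N then t%:R ^- 2 else 0) <= 1 :> R.
    by apply: (le_trans (sum_inv_sqr_le R T0)); rewrite gerBl invr_ge0.
  have ln2 : 0 < ln 2 :> R by rewrite ln_gt0// ltr1n.
  have lnT : ln 2 <= ln T%:R :> R by rewrite ler_ln ?posrE ?ltr0n// ler_nat.
  have d1 : 1 <= d%:R :> R by rewrite ler1n.
  apply: (le_trans (lerD cA (ler_wpM2l _ S1))); first by rewrite mulr_ge0.
  have y1 : 1 <= ln T%:R / ln 2 :> R by rewrite ler_pdivlMr// mul1r.
  (* The lower-order terms [1 + d + 2 d] are at most [4 d^3], and [ln T / ln 2 >= 1] absorbs
     them. *)
  have -> : d%:R ^+ 3 * (w + 4 / ln 2) * ln T%:R =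
    d%:R * (d%:R ^+ 2 * w * ln T%:R) + 4 * (d%:R ^+ 3 * (ln T%:R / ln 2)) :> R.
    by field; rewrite gt_eqF.
  have d3 : d%:R <= d%:R ^+ 3 :> R by rewrite -[leLHS]expr1 ler_weXn2l.
  have d3y : d%:R ^+ 3 <= d%:R ^+ 3 * (ln T%:R / ln 2) :> R.
    by rewrite ler_peMr// exprn_ge0.
  by lra.
rewrite /regret -[nth _ _ 0]/q expectation.unlock.
(* Shifting the index makes every summand refer to a positive time, where integrability holds. *)
rewrite (eq_integral (fun x =>
    \sum_(0 <= t < T) (instant_regret W pi q t.+1 x)%:E)%E); last first.
  by move=> x _; rewrite big_add1 sumEFin.
rewrite integral_sum//=; last by move=> t; exact: integrable_instant_regret.
apply: (@le_trans _ _ (\sum_(0 <= t < T) (D * h t.+1)%:E)%E).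
  apply: lee_sum => t _.
  have diff_leS x := diff_le t.+1 x isT.
  apply: (le_trans (expectation_instant_regret_le iidW intW nonant _ diff_leS)) => //.
  rewrite [leRHS]EFinM; apply: lee_wpmul2l; first by rewrite lee_fin !mulr_ge0.
  exact: bad_le.
rewrite sumEFin lee_fin -mulr_sumr -(big_add1 _ _ 0 T.+1 xpredT h).
apply: (le_trans (ler_wpM2l _ hsum)); first by rewrite !mulr_ge0.
by rewrite /D le_eqVlt; apply/predU1l; ring.
Qed.
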